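(* Let $\eta\in\Phi^+$ and $I(\eta)=\{i\in\{1,\dots,n\}\mid c_i(\eta)=m_i\}$. Then $\eta=\min V_{I(\eta)}$ if and only if $\eta$ is long and $(\eta,\alpha_i)\leq0$ for all $i\in\{1,\dots,n\}\setminus I(\eta)$. In particular, the set of the standard parabolic faces of $\mathcal P_\Phi$ is in bijection with the subset $\{\eta\in\Phi^+\mid\eta\text{ long and }(\eta,\alpha_i)\leq0\text{ for all }i\in\{1,\dots,n\}\setminus I(\eta)\}$ of $\Phi^+$.
   Context: $\Phi$ is a finite irreducible reduced crystallographic root system of rank $n$ in the Euclidean space $\mathrm{Span}_{\mathbb R}\Phi$ with scalar product $(\cdot,\cdot)$; $\Pi=\{\alpha_1,\dots,\alpha_n\}$ is a root basis, $\Phi^+$ the positive roots, $\theta=\sum_{i=1}^n m_i\alpha_i$ the highest root, and $\breve\omega_1,\dots,\breve\omega_n$ the basis dual to $\Pi$, i.e. $(\breve\omega_i,\alpha_j)=\delta_{ij}$. If $\Phi$ is simply laced, all roots are long. For a root $\alpha$, $c_i(\alpha)$ is the coefficient of $\alpha_i$ in $\alpha=\sum_i c_i(\alpha)\alpha_i$. $\mathcal P_\Phi$ is the convex hull of $\Phi$. For $I\subseteq\{1,\dots,n\}$: $F_I=\{x\in\mathcal P_\Phi\mid(x,\breve\omega_i)=m_i\ \forall i\in I\}$ and $V_I=F_I\cap\Phi$ (so $V_\emptyset=\Phi$). Here the standard parabolic faces are the faces $F_I$ with $I\neq\emptyset$. Minima are taken with respect to the order on roots: $\alpha\leq\beta$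 iff $\beta-\alpha$ is a nonnegative linear combination of positive roots. *)

(* Defs.v *)
From HB Require Import structures.
From mathcomp Require Import all_boot all_order all_algebra finmap.
From mathcomp Require Import classical_sets functions reals convex.

Set Implicit Arguments.
Unset Strict Implicit.
Unset Printing Implicit Defensive.

Import Order.TTheory GRing.Theory Num.Theory.
Local Open Scope classical_set_scope.
Local Open Scope fset_scope.
Local Open Scope ring_scope.

(* The Euclidean space is a finite-dimensional real vector space E with a
   positive definite symmetric bilinear form dot. *)

Section RootSystems.
Context {R : realType} {E : vectType R} (dot : {dot E for idfun}).

Record root_system (Phi : {fset E}) : Prop := RootSystem {
  root_system_span : <<Phi>>%VS = fullv;
  root_system_neq0 : 0 \notin Phi;
  root_system_stable : forall a b, a \in Phi -> b \in Phi ->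
    b - (2 * dot b a / dot a a) *: a \in Phi;
  root_system_cryst : forall a b, a \in Phi -> b \in Phi ->
    2 * dot b a / dot a a \is a Num.int;
  root_system_reduced : forall a (c : R), a \in Phi -> c *: a \in Phi ->
    c = 1 \/ c = -1
}.

Definition irreducible_roots (Phi : {fset E}) : Prop :=
  Phi != fset0 /\
  forall A B : {fset E}, Phi = A `|` B ->
    (forall a b, a \in A -> b \in B -> dot a b = 0) ->
    A = fset0 \/ B = fset0.

Definition long_root (Phi : {fset E}) (a : E) : Prop :=
  a \in Phi /\ forall b, b \in Phi -> dot b b <= dot a a.

Section Base.
Context {n : nat} (Phi : {fset E}) (Pi : n.-tuple E).

(* The coefficient c_i(a) is coord Pi i a. *)
Definition root_basis : Prop :=
  [/\ basis_of fullv Pi,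
      {subset Pi <= Phi} &
      forall a, a \in Phi ->
        (forall i, coord Pi i a \is a Num.nat) \/
        (forall i, - coord Pi i a \is a Num.nat)].

Definition pos_roots : {fset E} :=
  [fset a in Phi | [forall i, 0 <= coord Pi i a]].

Definition root_le (a b : E) : Prop :=
  exists c : E -> R, (forall g, 0 <= c g) /\
    b - a = \sum_(g <- pos_roots) c g *: g.

Definition is_min (V : set E) (a : E) : Prop :=
  V a /\ forall b, V b -> root_le a b.

Definition highest_root (theta : E) : Prop :=
  theta \in Phi /\ forall b, b \in Phi -> root_le b theta.

Definition dual_basis (omega : 'I_n -> E) : Prop :=
  forall i j, dot (omega i) (tnth Pi j) = (i == j)%:R.

Definition root_polytope : set E :=
  smallest (@convex_set R E) [set` Phi].

Section Faces.
Context (theta : E) (omega : 'I_n -> E).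

Definition face (I : {set 'I_n}) : set E :=
  [set x | root_polytope x /\
           forall i, i \in I -> dot x (omega i) = coord Pi i theta].

Definition face_roots (I : {set 'I_n}) : set E :=
  face I `&` [set` Phi].

Definition standard_parabolic_faces : set (set E) :=
  [set F | exists2 I : {set 'I_n}, I != finset.set0 & F = face I].

Definition max_coefs (eta : E) : {set 'I_n} :=
  [set i | coord Pi i eta == coord Pi i theta].

End Faces.
End Base.
End RootSystems.

(* Main.v *)
Require Import Defs.
From HB Require Import structures.
From mathcomp Require Import all_boot all_order all_algebra finmap.
From mathcomp Require Import classical_sets functions reals convex.
From mathcomp Require Import interval_inference ring lra.
Import Order.TTheory GRing.Theory Num.Theory.
Set Implicit Arguments.
Unset Strict Implicit.
Unset Printing Implicit Defensive.
Local Open Scope classical_set_scope.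
Local Open Scope fset_scope.
Local Open Scope ring_scope.

(** Let w be an element of the parabolic subgroup of the Weyl group generated by
    the simple reflections outside I that makes as many positive roots negative
    as possible; then w sends every simple root outside I to a negative root.
    Since w preserves V_I and theta is its maximum, w theta is its minimum, and
    it is long.  Conversely, if eta in V_I is long and pairs nonpositively with
    the simple roots outside I, then (eta, eta - w theta) <= 0 because
    eta - w theta is a nonnegative combination of those roots; as both vectors
    have the same norm, eta = w theta.  For the bijection, the face F_I is
    determined by V_I, and V_I = V_(I(eta)) when eta = min V_I. *)

(** * Scalar products and reflections *)

Section EuclideanForm.
Context {R : realType} {E : vectType R} (dot : {dot E for idfun}).

Lemma dotC x y : dot x y = dot y x.
Proof. by rewrite hermC expr0 mul1r. Qed.

Lemma dot_eq0 x : (dot x x == 0) = (x == 0).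
Proof.
have [->|x0] := eqVneq x 0; first by rewrite linear0r eqxx.
by rewrite gt_eqF // neq0_dnorm_gt0.
Qed.

Lemma dot_ge0 x : 0 <= dot x x.
Proof.
have [->|x0] := eqVneq x 0; first by rewrite linear0r.
by rewrite ltW // neq0_dnorm_gt0.
Qed.

Lemma dotDl x y z : dot (x + y) z = dot x z + dot y z.
Proof. exact: linearDl. Qed.

Lemma dotBl x y z : dot (x - y) z = dot x z - dot y z.
Proof. exact: linearBl. Qed.

Lemma dotZl c x y : dot (c *: x) y = c * dot x y.
Proof. by rewrite linearZl_LR. Qed.

Lemma dotBr x y z : dot x (y - z) = dot x y - dot x z.
Proof. exact: linearBr. Qed.

Lemma dotZr c x y : dot x (c *: y) = c * dot x y.
Proof. by rewrite dotC dotZl dotC. Qed.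

Lemma dot_sumr x (I : finType) (F : I -> E) :
  dot x (\sum_i F i) = \sum_i dot x (F i).
Proof. exact: linear_sumr. Qed.

Definition reflection (a x : E) : E := x - (2 * dot x a / dot a a) *: a.

Lemma reflection_is_linear a : linear (reflection a).
Proof.
move=> c x y; rewrite /reflection dotDl dotZl !scalerBr !scalerA.
have -> : 2 * (c * dot x a + dot y a) / dot a a =
  c * (2 * dot x a / dot a a) + 2 * dot y a / dot a a by ring.
by rewrite scalerDl opprD addrACA.
Qed.

HB.instance Definition _ a :=
  GRing.isLinear.Build R E E *:%R (reflection a) (reflection_is_linear a).

Lemma reflection_self a : reflection a a = - a.
Proof.
have [->|a0] := eqVneq a 0; first by rewrite linear0 oppr0.
rewrite /reflection mulfK ?dot_eq0 // -[X in X - _]scale1r -scalerBl.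
by rewrite -scaleN1r; congr (_ *: _); ring.
Qed.

Lemma reflectionK a : involutive (reflection a).
Proof.
move=> x; rewrite {2}/reflection linearB linearZ /= reflection_self.
by rewrite scalerN opprK /reflection subrK.
Qed.

Lemma dot_reflection a x y : a != 0 ->
  dot (reflection a x) (reflection a y) = dot x y.
Proof.
move=> a0; rewrite /reflection !(dotBl, dotBr, dotZl, dotZr) (dotC a y).
by field; rewrite dot_eq0.
Qed.

(** The hypotheses force (x - y, x - y) <= 0; this serves to identify two long roots. *)
Lemma dot_max_eq x y : dot y y <= dot x x -> dot x x <= dot x y -> x = y.
Proof.
move=> yx xy; apply/eqP; rewrite -subr_eq0 -dot_eq0 eq_le dot_ge0 andbT.
by rewrite !(dotBl, dotBr) (dotC y x); lra.
Qed.

End EuclideanForm.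

(** * Coefficients, positive roots and the root order *)

Section RootBasis.
Context {R : realType} {E : vectType R} (dot : {dot E for idfun}) {n : nat}.
Context (Phi : {fset E}) (Pi : n.-tuple E).
Hypothesis hPhi : root_system dot Phi.
Hypothesis hPi : root_basis Phi Pi.
Local Notation alpha := (tnth Pi).
Local Notation coef := (coord Pi).
Local Notation pos := (pos_roots Phi Pi).

Lemma basisE x : x = \sum_i coef i x *: alpha i.
Proof.
case: hPi => hb _ _; rewrite {1}(coord_basis hb (memvf x)).
by apply: eq_bigr => i _; rewrite (tnth_nth 0).
Qed.

Lemma coef_basis i j : coef i (alpha j) = (i == j)%:R.
Proof.
case: hPi => hb _ _; rewrite (tnth_nth 0) coord_free ?(basis_free hb) //.
by rewrite eq_sym.
Qed.

Lemma coef_inj x y : (forall i, coef i x = coef i y) -> x = y.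
Proof.
by move=> xy; rewrite [x]basisE [y]basisE; apply: eq_bigr => i _; rewrite xy.
Qed.

Lemma simple_root i : alpha i \in Phi.
Proof. by case: hPi => _ sPi _; apply/sPi/mem_tnth. Qed.

Lemma root_neq0 a : a \in Phi -> a != 0.
Proof. by move=> aPhi; apply: contraNneq (root_system_neq0 hPhi) => <-. Qed.

Lemma pos_rootP a : reflect (a \in Phi /\ forall i, 0 <= coef i a) (a \in pos).
Proof.
rewrite !inE /=; apply: (iffP andP) => -[aP /= ha]; split=> //; exact/forallP.
Qed.

(** The coefficients of a root share a sign, so one positive coefficient decides. *)
Lemma pos_root a i : a \in Phi -> 0 < coef i a -> a \in pos.
Proof.
case: hPi => _ _ /[swap] aPhi /(_ a aPhi) [ha|ha] ai.
  by apply/pos_rootP; split=> // k; apply: natr_ge0.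
by have := natr_ge0 (ha i); rewrite oppr_ge0 leNgt ai.
Qed.

Lemma nonpos_root a i : a \in Phi -> a \notin pos -> coef i a <= 0.
Proof. by move=> aPhi; rewrite leNgt; apply: contra; apply: pos_root. Qed.

Lemma simple_pos i : alpha i \in pos.
Proof. by apply: (@pos_root _ i); rewrite ?simple_root // coef_basis eqxx. Qed.

Lemma root_leP a b : root_le Phi Pi a b <-> forall i, coef i a <= coef i b.
Proof.
split=> [[c [c0 cE]] i|ab].
  rewrite -subr_ge0 -linearB cE linear_sum big_seq sumr_ge0 // => g.
  by case/pos_rootP => _ g0; rewrite linearZ /= mulr_ge0.
(* The weight of [g] collects every index [i] with [alpha i = g], which avoids inverting [alpha]. *)
exists (fun g => \sum_(i | g == alpha i) coef i (b - a)); split.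
  by move=> g; apply: sumr_ge0 => i _; rewrite linearB /= subr_ge0.
under eq_bigr => g _ do rewrite scaler_suml.
rewrite (exchange_big_dep predT) //= [LHS]basisE; apply: eq_bigr => i _.
by rewrite -big_filter filter_pred1_uniq ?fset_uniq ?simple_pos ?big_seq1.
Qed.

Lemma root_le_anti a b : root_le Phi Pi a b -> root_le Phi Pi b a -> a = b.
Proof.
move=> /root_leP ab /root_leP ba.
by apply: coef_inj => i; apply: le_anti; rewrite ab ba.
Qed.

Lemma is_min_uniq V a b : is_min Phi Pi V a -> is_min Phi Pi V b -> a = b.
Proof.
move=> [Va mina] [Vb minb].
by apply: root_le_anti; [apply: mina|apply: minb].
Qed.

(** * Simple reflections and the parabolic subgroups they generate *)

Lemma coef_reflection i j x : i != j ->
  coef i (reflection dot (alpha j) x) = coef i x.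
Proof.
by move=> /negPf ij; rewrite linearB linearZ /= coef_basis ij mulr0 subr0.
Qed.

Lemma reflection_root a b : a \in Phi -> b \in Phi -> reflection dot a b \in Phi.
Proof. exact: root_system_stable. Qed.

(* Reducedness: a positive root other than [alpha j] has another positive
   coefficient, which the reflection leaves unchanged. *)
Lemma reflection_pos j b : b \in pos -> b != alpha j ->
  reflection dot (alpha j) b \in pos.
Proof.
move=> /pos_rootP [bPhi b0] bj.
have [/existsP [i /andP[ij bi]]|/existsPn none] :=
    boolP [exists i, (i != j) && (coef i b != 0)].
  apply: (@pos_root _ i); first by rewrite reflection_root // simple_root.
  by rewrite coef_reflection // lt_neqAle eq_sym bi b0.
have bE : b = coef j b *: alpha j.
  rewrite {1}[b]basisE (bigD1 j) //= big1 ?addr0 // => i ij.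
  by have := none i; rewrite ij /= negbK => /eqP ->; rewrite scale0r.
have [] := @root_system_reduced _ _ _ _ hPhi (alpha j) (coef j b) (simple_root j).
- by rewrite -bE.
- by move=> c1; rewrite bE c1 scale1r eqxx in bj.
- by move=> c1; have := b0 j; rewrite c1 ler0N1.
Qed.

(* Satisfied by the elements of the parabolic subgroup of the Weyl group
   generated by the simple reflections outside [I]. *)
Record parabolic (I : {set 'I_n}) (w : {linear E -> E}) : Prop := Parabolic {
  parabolic_dot : forall x y, dot (w x) (w y) = dot x y;
  parabolic_root : forall a, a \in Phi -> w a \in Phi;
  parabolic_onto : forall b, b \in Phi -> exists2 a, a \in Phi & b = w a;
  parabolic_coef : forall i x, i \in I -> coef i (w x) = coef i x
}.

Lemma parabolic_id I : parabolic I (idfun : {linear E -> E}).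
Proof. by split=> // b bPhi; exists b. Qed.

Lemma parabolic_comp I (w : {linear E -> E}) j : parabolic I w -> j \notin I ->
  parabolic I (w \o reflection dot (alpha j) : {linear E -> E}).
Proof.
move=> [wdot wroot wonto wcoef] jI.
have aj := simple_root j.
split=> [x y|a aPhi|b bPhi|i x iI] /=.
- by rewrite wdot dot_reflection // root_neq0.
- exact/wroot/reflection_root.
- have [a aPhi ->] := wonto b bPhi; exists (reflection dot (alpha j) a).
    exact: reflection_root.
  by rewrite /= reflectionK.
- rewrite wcoef // coef_reflection //.
  by apply: contraNneq jI => <-.
Qed.

(** Induction on the number of inversions: while some [w (alpha j)] with [j] outside [I] is
    positive, composing with the reflection in [alpha j] adds at least one, and the number of
    positive roots bounds them. *)
Lemma parabolic_opposite I : exists2 w : {linear E -> E},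
  parabolic I w & forall j, j \notin I -> w (alpha j) \notin pos.
Proof.
pose inv (w : E -> E) := [fset b in pos | w b \notin pos].
have invE w b : (b \in inv w) = (b \in pos) && (w b \notin pos).
  by rewrite !inE.
suff [w wP [|wneg]] : exists2 w : {linear E -> E}, parabolic I w &
    (#|` pos| < #|` inv w|)%N \/ forall j, j \notin I -> w (alpha j) \notin pos;
  [|by exists w|].
  rewrite ltnNge fsubset_leq_card //.
  by apply/fsubsetP => b; rewrite invE => /andP[].
elim: #|` pos|.+1 => [|k [w wP [kw|wneg]]]; last by exists w => //; right.
  by exists idfun; [exact: parabolic_id|left].
have [/forallP wneg|/forallPn [j]] :=
    boolP [forall j, (j \notin I) ==> (w (alpha j) \notin pos)].
  by exists w => //; right=> j; apply/implyP.
rewrite negb_imply negbK => /andP[jI wj].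
set s := reflection dot (alpha j).
exists (w \o s : {linear E -> E}); first exact: parabolic_comp.
left; apply: (leq_ltn_trans kw).
have wsj : w (s (alpha j)) \notin pos.
  have /pos_rootP [wjPhi wj0] := wj.
  (* [w (alpha j)] is nonzero, so its opposite has a negative coefficient. *)
  have [i wi] : exists i, 0 < coef i (w (alpha j)).
    apply/existsP; apply: contraNT (root_neq0 wjPhi) => /existsPn none.
    apply/eqP/coef_inj => i; rewrite linear0; apply/eqP.
    by have := none i; rewrite lt_neqAle wj0 andbT negbK eq_sym.
  apply/pos_rootP => -[_ /(_ i)].
  by rewrite /s reflection_self !linearN /= oppr_ge0 leNgt wi.
have jimg : alpha j \notin s @` inv w.
  apply/imfsetP => -[b /=]; rewrite invE => /andP[/pos_rootP [_ /(_ j)]].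
  move=> + _ bE; rewrite -[b](reflectionK dot (alpha j)) -/s -bE.
  by rewrite /s reflection_self linearN /= coef_basis eqxx ler0N1.
(* The new inversion is [alpha j]; the old ones survive, moved by [s]. *)
suff /fsubset_leq_card : alpha j |` s @` inv w `<=` inv (w \o s).
  by rewrite cardfsU1 jimg card_imfset //; exact/inv_inj/reflectionK.
apply/fsubsetP => b; rewrite in_fset1U => /orP [/eqP ->|/imfsetP [c /= + ->]].
  by rewrite invE simple_pos.
rewrite !invE /= {2}/s reflectionK => /andP[cpos wc]; rewrite wc andbT.
(* [w] keeps [alpha j] positive but not [c], so the two differ and [s] keeps [c] positive. *)
by apply: reflection_pos => //; apply: contraNneq wc => ->.
Qed.

(** * Faces of the root polytope and minima of their sets of roots *)

Section Faces.
Context (theta : E) (omega : 'I_n -> E).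
Hypothesis htheta : highest_root Phi Pi theta.
Hypothesis homega : dual_basis dot Pi omega.
Local Notation face := (face dot Phi Pi theta omega).
Local Notation face_roots := (face_roots dot Phi Pi theta omega).
Local Notation max_coefs := (max_coefs Pi theta).

Lemma dot_omega x i : dot x (omega i) = coef i x.
Proof.
rewrite dotC {1}[x]basisE dot_sumr (bigD1 i) //= big1 => [|j ji].
  by rewrite dotZr homega eqxx mulr1 addr0.
by rewrite dotZr homega eq_sym (negPf ji) mulr0.
Qed.

Lemma coef_le_theta a i : a \in Phi -> coef i a <= coef i theta.
Proof. by case: htheta => _ /(_ a) /[apply] /root_leP. Qed.

Lemma theta_gt0 i : 0 < coef i theta.
Proof.
by apply: lt_le_trans (coef_le_theta i (simple_root i)); rewrite coef_basis eqxx.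
Qed.

Lemma face_rootsP I a : face_roots I a <->
  a \in Phi /\ forall i, i \in I -> coef i a = coef i theta.
Proof.
split=> [[[_ aI] aPhi]|[aPhi aI]].
  by split=> // i iI; rewrite -dot_omega aI.
by split=> //; split=> [|i iI]; [exact: sub_gen_smallest|rewrite dot_omega aI].
Qed.

Lemma face_roots_max_coefs a : a \in Phi -> face_roots (max_coefs a) a.
Proof. by move=> aPhi; apply/face_rootsP; split=> // i; rewrite inE => /eqP. Qed.

(** The reflection of [theta] in [alpha i] is a root, so its coefficient at [alpha i] cannot exceed
    that of [theta]. *)
Lemma theta_dominant i : 0 <= dot theta (alpha i).
Proof.
have [tPhi _] := htheta.
have := coef_le_theta i (reflection_root (simple_root i) tPhi).
rewrite linearB linearZ /= coef_basis eqxx mulr1 gerBl.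
by rewrite pmulr_lge0 ?invr_gt0 ?neq0_dnorm_gt0 ?root_neq0 ?simple_root // pmulr_rge0.
Qed.

(* A root of maximal height among the longest ones is dominant, so pairing it
   with [theta] bounds its norm by that of [theta]. *)
Lemma theta_long : long_root dot Phi theta.
Proof.
have [tPhi _] := htheta; split=> // b bPhi.
pose ht x := \sum_i coef i x.
pose b0 : Phi := [` bPhi].
(* Reflections preserve this norm condition, so the reflections of a candidate are again
   candidates. *)
pose P (x : Phi) := dot (val x) (val x) == dot b b.
have [[c cPhi] /= /eqP cb cmax] :=
  @arg_maxP _ _ _ b0 P (fun x => ht (val x)) (eqxx _).
have c_dom i : 0 <= dot c (alpha i).
  have a0 : alpha i != 0 by rewrite root_neq0 ?simple_root.
  have rPhi := reflection_root (simple_root i) cPhi.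
  have /= := cmax [` rPhi]; rewrite /P /= dot_reflection // cb eqxx.
  move=> /(_ isT); rewrite -subr_ge0 /ht -sumrB (bigD1 i) //= big1 => [|j ji].
    rewrite addr0 linearB linearZ /= coef_basis eqxx mulr1 opprB addrC subrK.
    by rewrite pmulr_lge0 ?invr_gt0 ?neq0_dnorm_gt0 // pmulr_rge0.
  by rewrite coef_reflection ?subrr.
(* Taken at [c] and at [theta], this gives (c, c) <= (c, theta) <= (theta, theta). *)
have pairing_ge0 x : (forall i, 0 <= dot x (alpha i)) -> 0 <= dot x (theta - c).
  move=> x0; rewrite [theta - c]basisE dot_sumr sumr_ge0 // => i _.
  by rewrite dotZr mulr_ge0 // linearB /= subr_ge0 coef_le_theta.
have := pairing_ge0 _ c_dom; have := pairing_ge0 _ theta_dominant.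
by rewrite !dotBr -cb (dotC dot c); lra.
Qed.

(* If [w] makes every simple root outside [I] negative, it reverses the order
   on [V_I], so it sends the maximum [theta] to the minimum. *)
Lemma face_roots_min I :
  exists2 a, long_root dot Phi a & is_min Phi Pi (face_roots I) a.
Proof.
have [w [wdot wroot wonto wcoef] wneg] := parabolic_opposite I.
have [tPhi tmax] := theta_long.
exists (w theta); first by split=> [|b bPhi]; [exact: wroot|rewrite wdot tmax].
split=> [|b /face_rootsP [bPhi bI]].
  by apply/face_rootsP; split=> [|i iI]; [exact: wroot|exact: wcoef].
have [a aPhi ba] := wonto b bPhi; apply/root_leP => i.
(* Expand w (theta - a) in the w (alpha j): the coefficient vanishes for [j] in [I], and w (alpha j)
   is negative otherwise. *)
rewrite ba -subr_le0 -linearB /= -linearB [theta - a]basisE !linear_sum.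
rewrite sumr_le0 // => j _; rewrite !linearZ /=.
have [jI|jI] := boolP (j \in I).
  by rewrite linearB /= -bI // ba wcoef // subrr mul0r.
rewrite mulr_ge0_le0 ?linearB /= ?subr_ge0 ?coef_le_theta //.
by apply: nonpos_root (wneg j jI); exact/wroot/simple_root.
Qed.

(** The reflection in [alpha i] sends [a] into V_I, and minimality forbids it to lower [a]. *)
Lemma min_antidominant I a i : is_min Phi Pi (face_roots I) a -> i \notin I ->
  dot a (alpha i) <= 0.
Proof.
move=> [/face_rootsP [aPhi aI] mina] iI.
have /mina /root_leP /(_ i) : face_roots I (reflection dot (alpha i) a).
  apply/face_rootsP; split=> [|j jI]; first exact/reflection_root/aPhi/simple_root.
  by rewrite coef_reflection ?aI //; apply: contraNneq iI => <-.
rewrite linearB linearZ /= coef_basis eqxx mulr1 lerBrDl gerDr.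
by rewrite pmulr_lle0 ?invr_gt0 ?neq0_dnorm_gt0 ?root_neq0 ?simple_root // pmulr_rle0.
Qed.

Lemma antidominant_min I a : long_root dot Phi a -> face_roots I a ->
  (forall i, i \notin I -> dot a (alpha i) <= 0) ->
  is_min Phi Pi (face_roots I) a.
Proof.
move=> [_ amax] Va aneg; have [b [bPhi bmax] bmin] := face_roots_min I.
have [aPhi aI] := (face_rootsP I a).1 Va.
have [/face_rootsP [_ bI] /(_ a Va) /root_leP ba] := bmin.
suff -> : a = b by [].
apply: (@dot_max_eq _ _ dot); first exact: amax.
(* [a - b] is a nonnegative combination of simple roots outside [I]. *)
rewrite -subr_le0 -dotBr [a - b]basisE dot_sumr sumr_le0 // => i _.
rewrite dotZr linearB /=; have [iI|iI] := boolP (i \in I).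
  by rewrite aI // bI // subrr mul0r.
by rewrite mulr_ge0_le0 ?subr_ge0 ?aneg.
Qed.

(** A face is thus determined by its roots: the implication between maximality conditions passes
    from the roots to their convex hull. *)
Lemma face_sub I J :
  (face_roots I `<=` face_roots J -> face I `<=` face J)%classic.
Proof.
move=> IJ x [xP xI].
(* The second conjunct of [C] is stable under convex combinations because of the
   first: a combination lies on a supporting hyperplane only if both ends do. *)
pose C : set E := [set y | (forall i, coef i y <= coef i theta) /\
  ((forall i, i \in I -> coef i y = coef i theta) ->
   forall i, i \in J -> coef i y = coef i theta)].
suff /(_ x xP) [_ xJ] : (root_polytope Phi `<=` C)%classic.
  split=> // i iJ; rewrite dot_omega xJ // => k kI; rewrite -dot_omega; exact: xI.
apply: smallest_sub => [|a aPhi].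
  (* Weights strictly between 0 and 1 suffice; a zero weight would leave one end unconstrained. *)
  apply/convex_setW => y z /set_mem [yle yI] /set_mem [zle zI] k k0 k1.
  have convE i : coef i (conv k y z) = k%:num * coef i y + (1 - k%:num) * coef i z.
    by rewrite linearD !linearZ.
  apply/mem_set; split=> [i|convI i iJ].
    by rewrite convE; have := yle i; have := zle i; nra.
  have ends j : j \in I -> coef j y = coef j theta /\ coef j z = coef j theta.
    move=> /convI; rewrite convE; have := yle j; have := zle j.
    by split; nra.
  rewrite convE yI ?zI //; first by ring.
  - by move=> j /ends [].
  - by move=> j /ends [].
split=> [i|aI i iJ]; first exact: coef_le_theta.
by have /IJ/face_rootsP [_ ->] : face_roots I a by apply/face_rootsP.
Qed.

(** Where [a] attains the maximal coefficient, so does every root of V_I, since it lies above [a];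
    hence V_I = V_(I(a)). *)
Lemma face_max_coefs I a : is_min Phi Pi (face_roots I) a ->
  face I = face (max_coefs a).
Proof.
move=> [/face_rootsP [aPhi aI] mina].
apply/seteqP; split; apply: face_sub => b /[dup] Vb /face_rootsP [bPhi bI].
  apply/face_rootsP; split=> // i; rewrite inE => /eqP ai.
  by apply: le_anti; rewrite coef_le_theta // -ai (root_leP _ _).1 //; apply: mina.
by apply/face_rootsP; split=> // i iI; apply: bI; rewrite inE aI.
Qed.

Lemma is_min_max_coefs a : a \in pos ->
  is_min Phi Pi (face_roots (max_coefs a)) a <->
  (long_root dot Phi a /\
   forall i, i \notin max_coefs a -> dot a (alpha i) <= 0).
Proof.
move=> /pos_rootP [aPhi _]; split=> [mina|[along aneg]].
  split=> [|i]; last exact: min_antidominant.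
  (* Uniqueness of the minimum identifies [a] with the long one. *)
  by have [b blong /(is_min_uniq mina) ->] := face_roots_min (max_coefs a).
by apply: antidominant_min => //; exact: face_roots_max_coefs.
Qed.

(** Otherwise [a] would pair nonpositively with all simple roots, giving (a, a) <= 0. *)
Lemma antidominant_max_coefs_neq0 a : a \in pos ->
  (forall i, i \notin max_coefs a -> dot a (alpha i) <= 0) ->
  max_coefs a != finset.set0.
Proof.
move=> /pos_rootP [aPhi a0] aneg; apply: contraTneq isT => I0.
have : 0 < dot a a by rewrite neq0_dnorm_gt0 ?root_neq0.
rewrite {2}[a]basisE dot_sumr ltNge sumr_le0 // => i _.
by rewrite dotZr mulr_ge0_le0 // aneg // I0 inE.
Qed.

End Faces.
End RootBasis.

Theorem proposition3p9 (R : realType) (E : vectType R) (dot : {dot E for idfun})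
  (n : nat) (Phi : {fset E}) (Pi : n.-tuple E) (theta : E) (omega : 'I_n -> E)
  (hPhi : root_system dot Phi) (hirr : irreducible_roots dot Phi)
  (hPi : root_basis Phi Pi) (htheta : highest_root Phi Pi theta)
  (homega : dual_basis dot Pi omega) :
  (forall eta, eta \in pos_roots Phi Pi ->
     is_min Phi Pi (face_roots dot Phi Pi theta omega (max_coefs Pi theta eta)) eta
     <->
     (long_root dot Phi eta /\
      forall i, i \notin max_coefs Pi theta eta -> dot eta (tnth Pi i) <= 0))
  /\
  set_bij
    [set eta | eta \in pos_roots Phi Pi /\
       (long_root dot Phi eta /\
        forall i, i \notin max_coefs Pi theta eta -> dot eta (tnth Pi i) <= 0)]
    (standard_parabolic_faces dot Phi Pi theta omega)
    (fun eta => face dot Phi Pi theta omega (max_coefs Pi theta eta)).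
Proof.
split; first by move=> eta; exact: is_min_max_coefs.
split=> [eta [etapos [_ etaneg]]|eta eta'|F [I I0 ->]].
- exists (max_coefs Pi theta eta) => //.
  exact: (antidominant_max_coefs_neq0 hPhi hPi etapos etaneg).
- move=> /set_mem [etapos etaP] /set_mem [etapos' etaP'] faceE.
  have := (is_min_max_coefs hPhi hPi htheta homega etapos).2 etaP.
  have := (is_min_max_coefs hPhi hPi htheta homega etapos').2 etaP'.
  (* Equal faces contain the same roots, so [eta] and [eta'] are minima of one set. *)
  rewrite /face_roots faceE => min' min; exact: is_min_uniq hPi _ _ _ min min'.
- have [eta _ mineta] := face_roots_min hPhi hPi htheta homega I.
  have faceE := face_max_coefs hPi htheta homega mineta.
  (* [I] is nonempty, and c_i(eta) = m_i > 0 for [i] in [I]. *)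
  have etapos : eta \in pos_roots Phi Pi.
    have [i iI] := set0Pn _ I0.
    have /(face_rootsP hPi theta homega) [etaPhi etaI] := mineta.1.
    by apply: (pos_root hPi (i := i)); rewrite ?etaI ?(theta_gt0 hPi htheta).
  exists eta => //; split=> //.
  apply/(is_min_max_coefs hPhi hPi htheta homega etapos).
  by rewrite /face_roots -faceE.
Qed.
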